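(* For all integers $d\geq 2$ and $k\geq 1$, we have \[N_{[d]}^{\mathrm{non}}(k)\leq N_{d\text{-ary}}^{\mathrm{non}}(k)\leq d\left(N_{[d]}^{\mathrm{non}}(k)-1\right)+1.\]
   Context: Let $d\geq 2$ be an integer. $d$-ary plane trees. A $d$-ary plane tree is either an empty tree or a root vertex with $d$ subtrees that are linearly ordered from left to right and are themselves $d$-ary plane trees (the subtrees of a vertex may be empty). The $i$-th subtree of a vertex is the $i$-th from the left; an edge has type $i$ if it connects a vertex to the root of its $i$-th subtree. For a vertex $u$, let $\chi(u)$ be the set of $i\in\{1,\dots,d\}$ such that the $i$-th subtree of $u$ is nonempty. Let $e$ be an edge of type $i$ connecting $u$ to its child $v$. Contracting $e$ (merging $v$ into $u$, all other edges keeping their types, so that the merged vertex has nonempty subtrees in the positions $(\chi(u)\setminus\{i\})\cup\chi(v)$) is a legal contraction if every element of $\chi(u)\setminus\{i\}$ that is smaller than $i$ is strictly smaller than $\min(\chi(v))$ and every element of $\chi(u)\setminus\{i\}$ that is greater than $i$ is strictly greater than $\max(\chi(v))$; this condition is vacuous if $v$ is a leaf. $[d]$-trees. A $[d]$-tree is a rooted tree in which the children of each vertex are linearly ordered from left to right and the number of children of each vertex is an element of $\{0,1,\dots,d\}$. Let $e$ be an edge in a $[d]$-tree that connects a vertex $u$ to one of its children $v$. If the total number of children of $u$ and $v$, excluding $v$ itself, is at most $d$, then contracting $e$ is a legal contraction; in the contracted tree, the children of $v$ take the place of $v$ in the ordered list of children of $u$ (so children of $u$ to the left, respectively right, of $v$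 remain to the left, respectively right, of the children of $v$). For either type of tree, $\mathcal T$ noncontiguously contains $T$ if $T$ can be obtained from $\mathcal T$ by a (possibly empty) sequence of legal edge contractions. $N_{d\text{-ary}}^{\mathrm{non}}(k)$ (respectively, $N_{[d]}^{\mathrm{non}}(k)$) denotes the minimum number of vertices in a $d$-ary plane tree (respectively, $[d]$-tree) that noncontiguously contains every $d$-ary plane tree (respectively, $[d]$-tree) with $k$ vertices. *)

(* Defs.v *)
From mathcomp Require Import all_boot.
From mathcomp Require Import boolp.
From Stdlib Require Export Relation_Operators.

Set Implicit Arguments.
Unset Strict Implicit.
Unset Printing Implicit Defensive.

Section DaryPlaneTrees.

Variable d : nat.

(* Child positions are 0, ..., d - 1 instead of 1, ..., d. *)
Inductive dary : Type :=
| DEmpty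
| DNode of {ffun 'I_d -> dary}.

Definition is_dempty (t : dary) : bool := if t is DEmpty then true else false.

Fixpoint dary_size (t : dary) : nat :=
  match t with
  | DEmpty => 0
  | DNode f => (\sum_(i < d) dary_size (f i)).+1
  end.

Definition chi (f : {ffun 'I_d -> dary}) : {set 'I_d} :=
  [set i | ~~ is_dempty (f i)].

(* The comparisons with min (chi g) and max (chi g) are written elementwise,
   so that both conditions hold vacuously when chi g is empty. *)
Definition dary_legal (f : {ffun 'I_d -> dary}) (i : 'I_d)
    (g : {ffun 'I_d -> dary}) : Prop :=
  (forall j, j \in chi f :\ i -> j < i -> forall m, m \in chi g -> j < m) /\
  (forall j, j \in chi f :\ i -> i < j -> forall m, m \in chi g -> m < j).

(* In a legal contraction, chi f :\ i and chi g are disjoint. *)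
Definition dary_merge (f : {ffun 'I_d -> dary}) (i : 'I_d)
    (g : {ffun 'I_d -> dary}) : {ffun 'I_d -> dary} :=
  [ffun j => if j \in chi f :\ i then f j else g j].

Inductive dary_contract : dary -> dary -> Prop :=
| dary_contract_root (f g : {ffun 'I_d -> dary}) (i : 'I_d) :
    f i = DNode g -> dary_legal f i g ->
    dary_contract (DNode f) (DNode (dary_merge f i g))
| dary_contract_sub (f : {ffun 'I_d -> dary}) (i : 'I_d) (t : dary) :
    dary_contract (f i) t ->
    dary_contract (DNode f) (DNode [ffun j => if j == i then t else f j]).

Definition dary_contains : dary -> dary -> Prop :=
  clos_refl_trans dary dary_contract.

Definition dary_universal (k : nat) (S : dary) : Prop :=
  forall T : dary, dary_size T = k -> dary_contains S T.

End DaryPlaneTrees.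

Arguments DEmpty {d}.

Inductive otree : Type := ONode of seq otree.

Fixpoint otree_size (t : otree) : nat :=
  let: ONode s := t in (sumn (map otree_size s)).+1.

(* t is a [d]-tree. *)
Fixpoint is_brtree (d : nat) (t : otree) : bool :=
  let: ONode s := t in (size s <= d) && all (is_brtree d) s.

(* The degree condition makes contraction preserve is_brtree d. *)
Inductive br_contract (d : nat) : otree -> otree -> Prop :=
| br_contract_root (l cs r : seq otree) :
    size l + size cs + size r <= d ->
    br_contract d (ONode (l ++ ONode cs :: r)) (ONode (l ++ cs ++ r))
| br_contract_sub (l r : seq otree) (t t' : otree) :
    br_contract d t t' ->
    br_contract d (ONode (l ++ t :: r)) (ONode (l ++ t' :: r)).

Definition br_contains (d : nat) : otree -> otree -> Prop :=
  clos_refl_trans otree (br_contract d).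

Definition br_universal (d k : nat) (S : otree) : Prop :=
  forall T : otree, is_brtree d T -> otree_size T = k -> br_contains d S T.

(* Complete trees are universal since contracting a leaf is always legal;
   hence the minima below exist. *)

Fixpoint dary_complete (d n : nat) : dary d :=
  if n is n'.+1 then DNode [ffun _ => dary_complete d n']
  else DNode [ffun _ => DEmpty].

Lemma dary_contains_sub d (f : {ffun 'I_d -> dary d}) (i : 'I_d) (t : dary d) :
  dary_contains (f i) t ->
  dary_contains (DNode f) (DNode [ffun j => if j == i then t else f j]).
Proof.
move=> H.
have -> : DNode f = DNode [ffun j => if j == i then f i else f j].
  by congr DNode; apply/ffunP => j; rewrite ffunE; case: eqP => [->|].
elim: H => [x y xy|x|x y z _ IH1 _ IH2].
- have := @dary_contract_sub d [ffun j => if j == i then x else f j] i y.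
  rewrite ffunE eqxx => /(_ xy) H; apply: rt_step.
  suff -> : [ffun j => if j == i then y else f j] = [ffun j => if j == i then y
     else [ffun j => if j == i then x else f j] j] by [].
  by apply/ffunP => j; rewrite !ffunE; case: eqP.
- exact: rt_refl.
- exact: rt_trans IH1 IH2.
Qed.

Lemma dary_contains_prune d (f : {ffun 'I_d -> dary d}) (i : 'I_d) :
  f i = DNode [ffun _ => DEmpty] ->
  dary_contains (DNode f) (DNode [ffun j => if j == i then DEmpty else f j]).
Proof.
move=> fi.
have -> : [ffun j => if j == i then DEmpty else f j] =
          dary_merge f i [ffun _ => DEmpty].
  apply/ffunP => j; rewrite !ffunE !inE; case: eqP => //= _.
  by case: (f j).
apply: rt_step; apply: dary_contract_root fi _.
by split=> j _ _ m; rewrite inE ffunE.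
Qed.

Lemma dary_complete_contains d n (t : dary d) :
  0 < dary_size t <= n.+1 -> dary_contains (dary_complete d n) t.
Proof.
elim: n t => [|n IH] [|g] //= /[!ltnS] szg.
  have -> : g = [ffun _ => DEmpty]; last exact: rt_refl.
  apply/ffunP => j; rewrite ffunE; move: szg; rewrite leqn0 sum_nat_eq0.
  by move=> /forallP/(_ j) /=; case: (g j).
have szi i : dary_size (g i) <= n.+1.
  by apply: leq_trans szg; rewrite (bigD1 i) //= leq_addr.
set c := dary_complete d n.
suff H (s : seq 'I_d) : dary_contains (DNode [ffun _ => c])
    (DNode [ffun j => if j \in s then g j else c]).
  have := H (enum 'I_d); congr (dary_contains _ (DNode _)).
  by apply/ffunP => j; rewrite ffunE mem_enum.
elim: s => [|i s IHs].
  by have -> : [ffun j => if j \in [::] then g j else c] = [ffun _ => c];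
    [apply/ffunP => j; rewrite !ffunE | exact: rt_refl].
apply: rt_trans IHs _.
set f := [ffun j => if j \in s then g j else c].
have -> : [ffun j => if j \in i :: s then g j else c] =
          [ffun j => if j == i then g i else f j].
  by apply/ffunP => j; rewrite !ffunE inE; case: eqP => [->|].
have [iS|iS] := boolP (i \in s).
  apply: dary_contains_sub; rewrite ffunE iS; exact: rt_refl.
have fi : f i = c by rewrite ffunE (negbTE iS).
case E: (g i) => [|h]; last first.
  apply: dary_contains_sub; rewrite fi; apply: IH.
  by rewrite -E szi E.
have Hl : dary_contains (f i) (DNode [ffun _ => DEmpty]).
  by rewrite fi; apply: IH => /=; rewrite big1 // => j _; rewrite ffunE.
apply: rt_trans (dary_contains_sub Hl) _.
set f' := [ffun j => _].
have -> : [ffun j => if j == i then DEmpty else f j] =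
          [ffun j => if j == i then DEmpty else f' j].
  by apply/ffunP => j; rewrite !ffunE; case: eqP.
by apply: dary_contains_prune; rewrite ffunE eqxx.
Qed.

Lemma dary_universal_exists d k :
  exists n : nat, `[< exists S : dary d, dary_size S = n /\ dary_universal k S >].
Proof.
case: k => [|k].
  exists 0; apply/asboolP; exists DEmpty; split=> // -[|f] //= _.
  exact: rt_refl.
exists (dary_size (dary_complete d k)); apply/asboolP.
exists (dary_complete d k); split=> // T sT.
by apply: dary_complete_contains; rewrite sT ltnSn.
Qed.

Fixpoint br_complete (d n : nat) : otree :=
  if n is n'.+1 then ONode (nseq d (br_complete d n')) else ONode [::].

Lemma br_complete_is_brtree d n : is_brtree d (br_complete d n).
Proof. by elim: n => //= n IH; rewrite size_nseq leqnn all_nseq IH orbT. Qed.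

Lemma br_contains_sub d (l r : seq otree) (t t' : otree) :
  br_contains d t t' ->
  br_contains d (ONode (l ++ t :: r)) (ONode (l ++ t' :: r)).
Proof.
elim=> [x y xy|x|x y z _ IH1 _ IH2].
- by apply: rt_step; apply: br_contract_sub.
- exact: rt_refl.
- exact: rt_trans IH1 IH2.
Qed.

Lemma br_complete_contains d n (t : otree) :
  is_brtree d t -> otree_size t <= n.+1 -> br_contains d (br_complete d n) t.
Proof.
elim: n t => [|n IH] [s] /= /andP[szs brs] /[!ltnS] ssz.
  case: s szs brs ssz => [|[s0] s] //= *; exact: rt_refl.
set c := br_complete d n.
have Hleaf : br_contains d c (ONode [::]) by apply: IH.
suff H (l : seq otree) m : size l + m <= d -> size s <= m ->
    br_contains d (ONode (l ++ nseq m c)) (ONode (l ++ s)).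
  by apply: (H [::] d).
elim: s {szs} m l brs ssz => [|t s IHs] m l /= brs ssz.
  elim: m => [|m IHm] lm _; first exact: rt_refl.
  apply: rt_trans (IHm _ _) => //; last by apply: leq_trans lm; rewrite leq_add2l.
  apply: rt_trans (br_contains_sub _ _ Hleaf) _.
  apply: rt_step; apply: (@br_contract_root d l [::]).
  by rewrite /= addn0 size_nseq; apply: leq_trans lm; rewrite leq_add2l.
case: m => // m lm /= sm.
case/andP: brs => brt brs.
have st : otree_size t <= n.+1 by apply: leq_trans ssz; rewrite leq_addr.
apply: rt_trans (br_contains_sub _ _ (IH t brt st)) _.
rewrite -!cat_rcons; apply: IHs => //.
- by apply: leq_trans ssz; rewrite leq_addl.
- by rewrite size_rcons addSnnS.
Qed.

Lemma br_universal_exists d k :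
  exists n : nat, `[< exists S : otree,
    [/\ is_brtree d S, otree_size S = n & br_universal d k S] >].
Proof.
exists (otree_size (br_complete d k)); apply/asboolP.
exists (br_complete d k); split=> //; first exact: br_complete_is_brtree.
by move=> T brT sT; apply: br_complete_contains => //; rewrite sT.
Qed.

Definition N_dary_non (d k : nat) : nat := ex_minn (dary_universal_exists d k).

Definition N_br_non (d k : nat) : nat := ex_minn (br_universal_exists d k).

(* Main.v *)
Require Import Defs.
From mathcomp Require Import all_boot.
From mathcomp Require Import boolp zify.

(** Lower bound.  Forgetting the types of the edges ([shape]) turns a d-ary
plane tree into a [d]-tree with as many vertices, and a legal contraction into
a legal contraction: the positions occupied by the two sets of children are
disjoint and correctly ordered ([dary_contract_shape]).  Every [d]-tree is the
shape of some d-ary plane tree, so the shape of a universal tree is universal.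

Upper bound.  Let S be a universal [d]-tree.  Replace each edge, from a vertex
to its child number p, by a path of d edges whose first edge has type p and
whose other edges have the types different from p, each once ([expand]).  The
new tree has d (|S| - 1) + 1 vertices ([dary_size_expand]).  Given a d-ary
plane tree T, its shape is obtained from S by contractions.  These
contractions are undone one at a time, from the shape of T back to S, while
types are assigned to the edges that reappear:
- when a contraction merged v into u and v has children in T, the edge uv gets
  the smallest of their types; the children of v occupy an interval of
  positions of the merged vertex, so contracting uv is legal;
- when v has no child left, the edge uv need not be typed at all: the subtree
  at v is recorded as deleted.
Hence there is a tree T0 that contains T and consists of S with some subtrees
deleted and with some type on each remaining edge; [fits S T0] says this, and
[fits_contains] is the induction.

It remains to contract [expand S] to T0 ([expand_contains]).  Deleting
subtrees is always legal, and a path of edges without other branches may drop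
any of its types, so the path of an edge that has type b in T0 can be reduced
to types p, b, or to p alone if b = p.  Contracting the first edge of a path
p, b then shifts a child of u from position p to position b.  This is legal
if no other child of u lies between; both the old and the new positions are
in increasing order, so some pending shift is always unobstructed
([matching_movable]), and all shifts can be performed in turn. *)

Set Implicit Arguments.
Unset Strict Implicit.
Unset Printing Implicit Defensive.

(** * Induction principles and partial order-preserving matchings *)

Definition oleaf : otree := ONode [::].

Lemma otree_nth_ind (P : otree -> Prop) :
  (forall s, (forall i, i < size s -> P (nth oleaf s i)) -> P (ONode s)) ->
  forall t, P t.
Proof.
move=> H; fix IH 1 => -[s]; apply: H.
elim: s => [|t s IHs]; first by clear IH.
by case=> [_|i /IHs]; [apply: IH | apply].
Qed.

(** [emb R s l] matches all of [l], in order, with a subsequence of [s]; the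
skipped entries of [s] are going to be the deleted subtrees. *)
Inductive emb (A B : Type) (R : A -> B -> Prop) : seq A -> seq B -> Prop :=
| emb_nil : emb R [::] [::]
| emb_skip x s l : emb R s l -> emb R (x :: s) l
| emb_cons x y s l : R x y -> emb R s l -> emb R (x :: s) (y :: l).

Lemma emb_catl A B (R : A -> B -> Prop) s1 s2 l : emb R (s1 ++ s2) l ->
  exists l1 l2, [/\ l = l1 ++ l2, emb R s1 l1 & emb R s2 l2].
Proof.
elim: s1 l => [|x s1 IH] l /= e; first by exists [::], l; split=> //; constructor.
inversion e as [|? ? ? e'|? y ? l' xy e']; subst;
  have [l1 [l2 [-> e1 e2]]] := IH _ e'.
- by exists l1, l2; split=> //; constructor.
- by exists (y :: l1), l2; split=> //; constructor.
Qed.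

Lemma emb_consl A B (R : A -> B -> Prop) x s l : emb R (x :: s) l ->
  emb R s l \/ exists y l', [/\ l = y :: l', R x y & emb R s l'].
Proof.
by move=> e; inversion e; subst; [left | right; exists y, l0; split].
Qed.

Lemma emb_cat A B (R : A -> B -> Prop) s1 s2 l1 l2 :
  emb R s1 l1 -> emb R s2 l2 -> emb R (s1 ++ s2) (l1 ++ l2).
Proof. by move=> e1 e2; elim: e1 => //= *; constructor. Qed.

Lemma emb_sub A (B : eqType) (R R' : A -> B -> Prop) s l :
  (forall x y, y \in l -> R x y -> R' x y) -> emb R s l -> emb R' s l.
Proof.
move=> RR' e; elim: e RR' => {s l} [|x s l _ IH|x y s l xy _ IH] RR'.
- exact: emb_nil.
- by apply: emb_skip; exact: IH.
apply: emb_cons; first by apply: RR' xy; exact: mem_head.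
by apply: IH => x' y' y'l; apply: RR'; rewrite inE y'l orbT.
Qed.

(** * d-ary plane trees *)

Section Dary.

Variable d : nat.
Implicit Types (f g h : {ffun 'I_d -> dary d}) (t u : dary d) (i j b : 'I_d).

Lemma dary_ffun_ind (P : dary d -> Prop) :
  P DEmpty -> (forall f, (forall i, P (f i)) -> P (DNode f)) -> forall t, P t.
Proof. by move=> H0 H; fix IH 1 => -[|f]; [apply: H0|apply: H]. Qed.

Lemma in_chi f i : (i \in chi f) = ~~ is_dempty (f i).
Proof. by rewrite inE. Qed.

Lemma notin_chi f i : i \notin chi f -> f i = DEmpty.
Proof. by rewrite inE negbK; case: (f i). Qed.

Definition ord_lt : rel 'I_d := relpre val ltn.

Lemma enum_set_pairwise (A : {set 'I_d}) : pairwise ord_lt (enum A).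
Proof.
rewrite -sorted_pairwise => [|x y z]; last exact: ltn_trans.
apply: sorted_filter => [x y z|]; first exact: ltn_trans.
by rewrite -sorted_map -enumT val_enum_ord iota_ltn_sorted.
Qed.

Lemma enum_set_unique (A : {set 'I_d}) (s : seq 'I_d) :
  pairwise ord_lt s -> s =i A -> enum A = s.
Proof.
move=> ss sA; apply: (@irr_sorted_eq _ ord_lt) => [x y z|x|||j].
- exact: ltn_trans.
- exact: ltnn.
- exact/pairwise_sorted/enum_set_pairwise.
- exact: pairwise_sorted.
- by rewrite mem_enum sA.
Qed.

Definition slot i t : {ffun 'I_d -> dary d} :=
  [ffun j => if j == i then t else DEmpty].

Lemma in_chi_slot i t j : (j \in chi (slot i t)) = (j == i) && ~~ is_dempty t.
Proof. by rewrite inE ffunE; case: eqP. Qed.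

(** Subtrees can be contracted independently of each other, and a slot that is
empty in [g] imposes no condition on [f]: a subtree contracts to a single leaf
(induction on the subtree), and contracting the edge to a leaf deletes it. *)
Lemma dary_contains_slots f g :
  (forall i, ~~ is_dempty (g i) -> dary_contains (f i) (g i)) ->
  dary_contains (DNode f) (DNode g).
Proof.
suff H t : t = DNode f ->
    (forall i, ~~ is_dempty (g i) -> dary_contains (f i) (g i)) ->
    dary_contains t (DNode g) by exact: H.
elim/dary_ffun_ind: t f g => [|f IH] // _ g [<-] fg.
suff H (s : seq 'I_d) : dary_contains (DNode f)
    (DNode [ffun j => if j \in s then g j else f j]).
  have := H (enum 'I_d); congr (dary_contains _ (DNode _)).
  by apply/ffunP => j; rewrite ffunE mem_enum.
elim: s => [|i s IHs].
  have -> : [ffun j => if j \in [::] then g j else f j] = f.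
    by apply/ffunP => j; rewrite ffunE.
  exact: rt_refl.
apply: rt_trans IHs _; set h := [ffun j => _].
have -> : [ffun j => if j \in i :: s then g j else f j] =
          [ffun j => if j == i then g i else h j].
  by apply/ffunP => j; rewrite !ffunE inE; case: eqP => [->|].
have [iS|iS] := boolP (i \in s).
  by apply: dary_contains_sub; rewrite ffunE iS; exact: rt_refl.
have hi : h i = f i by rewrite ffunE (negbTE iS).
case gi: (g i) => [|gi']; last first.
  by apply: dary_contains_sub; rewrite hi -gi; apply: fg; rewrite gi.
case fi: (f i) => [|f'].
  by apply: dary_contains_sub; rewrite hi fi; exact: rt_refl.
have toleaf : dary_contains (h i) (DNode [ffun _ => DEmpty]).
  by rewrite hi; apply: (IH i f') => // j; rewrite ffunE.
apply: rt_trans (dary_contains_sub toleaf) _; set h' := [ffun j => _].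
have -> : [ffun j => if j == i then DEmpty else h j] =
          [ffun j => if j == i then DEmpty else h' j].
  by apply/ffunP => j; rewrite !ffunE; case: eqP.
by apply: dary_contains_prune; rewrite ffunE eqxx.
Qed.

(** A contraction applies to, and produces, a nonempty tree only. *)
Lemma is_dempty_contains t t' :
  dary_contains t t' -> is_dempty t' = is_dempty t.
Proof. by elim=> {t t'} [_ _ []|//|t1 t2 t3 _ <- _ <-]. Qed.

(** Legality is vacuous for the edge to an only child. *)
Lemma dary_contains_slot i t : ~~ is_dempty t -> dary_contains (DNode (slot i t)) t.
Proof.
case: t => // g _; apply: rt_step.
have slot0 j : (j \in chi (slot i (DNode g)) :\ i) = false.
  by rewrite in_setD1 in_chi_slot; case: eqP.
have {2}-> : g = dary_merge (slot i (DNode g)) i g.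
  by apply/ffunP => j; rewrite ffunE slot0.
by apply: dary_contract_root; [rewrite ffunE eqxx | split=> j; rewrite slot0].
Qed.

Definition typed_path (l : seq 'I_d) t : dary d :=
  foldr (fun i u => DNode (slot i u)) t l.

Lemma typed_path_nonempty l t :
  ~~ is_dempty t -> ~~ is_dempty (typed_path l t).
Proof. by case: l. Qed.

Lemma typed_path_contains_end l t :
  ~~ is_dempty t -> dary_contains (typed_path l t) t.
Proof.
move=> t0; elim: l => [|i l IH] /=; first exact: rt_refl.
by apply: rt_trans (dary_contains_slot _ _) IH; exact: typed_path_nonempty.
Qed.

(** Each vertex of the path has one child, so every edge of the path can be
contracted regardless of types; here all but one, of type [b]. *)
Lemma typed_path_contains_slot l t b :
  ~~ is_dempty t -> b \in l -> dary_contains (typed_path l t) (DNode (slot b t)).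
Proof.
move=> t0 /path.splitPr[l1 l2]; rewrite /typed_path foldr_cat -/(typed_path _ _).
apply: rt_trans (typed_path_contains_end _ _) _ => //=.
apply: dary_contains_slots => i; rewrite !ffunE.
by case: eqP => // _ _; exact: typed_path_contains_end.
Qed.

Lemma typed_path_contains l t t' :
  dary_contains t t' -> dary_contains (typed_path l t) (typed_path l t').
Proof.
move=> tt'; elim: l => //= i l IH; apply: dary_contains_slots => j.
by rewrite !ffunE; case: eqP.
Qed.

Lemma dary_size_slot i t : dary_size (DNode (slot i t)) = (dary_size t).+1.
Proof.
rewrite /= (bigD1 i) //= ffunE eqxx big1 ?addn0 // => j /negbTE ji.
by rewrite ffunE ji.
Qed.

Lemma dary_size_typed_path l t : dary_size (typed_path l t) = size l + dary_size t.
Proof. by elim: l => //= i l IH; rewrite -/(dary_size (DNode _)) dary_size_slot IH. Qed.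

(** Child number [i] is placed in slot [i], at the end of a further path of types
[l i]; each edge of the [d]-tree becomes a path of [(size (l i)).+1] edges.
With empty [l i], this only equips the [d]-tree with types. *)
Fixpoint expand (l : 'I_d -> seq 'I_d) (T : otree) : dary d :=
  let: ONode s := T in
  DNode [ffun i : 'I_d => if i < size s
    then typed_path (l i) (nth DEmpty (map (expand l) s) i) else DEmpty].

Lemma expand_slot l s i : i < size s ->
  nth DEmpty (map (expand l) s) i = expand l (nth oleaf s i).
Proof. by move=> ?; rewrite (nth_map oleaf). Qed.

Lemma expand_nonempty l T : ~~ is_dempty (expand l T).
Proof. by case: T. Qed.

(** Each of the [otree_size T - 1] edges becomes a path of [w.+1] edges. *)
Lemma dary_size_expand l w T : (forall i, size (l i) = w) -> is_brtree d T ->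
  dary_size (expand l T) = w.+1 * (otree_size T - 1) + 1.
Proof.
move=> lw; elim/otree_nth_ind: T => s IH /= /andP[sd brs].
rewrite subSS subn0 addn1; congr _.+1.
transitivity (\sum_(i < d | i < size s) w.+1 * otree_size (nth oleaf s i)).
  rewrite [RHS]big_mkcond /=; apply: eq_bigr => i _; rewrite ffunE.
  case: ifP => // si; rewrite dary_size_typed_path lw expand_slot //.
  rewrite IH //; last exact: (all_nthP oleaf brs).
  by case: (nth oleaf s i) => s' /=; lia.
rewrite -big_distrr /= sumnE big_map (big_nth oleaf); congr (_ * _).
by rewrite big_mkord (big_ord_widen _ (fun i : nat => otree_size (nth oleaf s i)) sd).
Qed.

(** * Forgetting the types of edges *)

(** The value on the empty tree is a dummy: only nonempty subtrees are visited. *)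
Fixpoint shape t : otree :=
  if t is DNode f then ONode [seq shape (f i) | i <- enum (chi f)] else oleaf.

Lemma shape_expand_nil T : is_brtree d T -> shape (expand (fun=> [::]) T) = T.
Proof.
elim/otree_nth_ind: T => s IH /= /andP[sd brs]; congr ONode.
set f := [ffun i => _].
have chif i : (i \in chi f) = (i < size s).
  rewrite in_chi ffunE; case: ifP => // si.
  by rewrite /typed_path /= expand_slot // expand_nonempty.
have vals : map val (enum (chi f)) = iota 0 (size s).
  apply: (irr_sorted_eq ltn_trans ltnn) => [||n].
  - by rewrite sorted_map; exact/pairwise_sorted/enum_set_pairwise.
  - exact: iota_ltn_sorted.
  rewrite mem_iota add0n /=; apply/mapP/idP => [[i]|ns].
    by rewrite mem_enum chif => ? ->.
  by exists (Ordinal (leq_trans ns sd)); rewrite ?mem_enum ?chif.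
rewrite -[RHS](mkseq_nth oleaf) /mkseq -vals -map_comp.
apply/eq_in_map => i; rewrite mem_enum chif => si /=.
by rewrite ffunE si /= expand_slot // IH //; exact: (all_nthP oleaf brs).
Qed.

Lemma is_brtree_shape t : is_brtree d (shape t).
Proof.
elim/dary_ffun_ind: t => //= f IH; rewrite size_map -cardE.
rewrite -[X in _ <= X]card_ord max_card /= all_map.
by apply/allP => i _; exact: IH.
Qed.

Lemma otree_size_shape f : otree_size (shape (DNode f)) = dary_size (DNode f).
Proof.
suff H t : ~~ is_dempty t -> otree_size (shape t) = dary_size t by exact: H.
elim/dary_ffun_ind: t => //= {}f IH _; congr _.+1.
rewrite -map_comp sumnE big_map big_enum /= [RHS](bigID (mem (chi f))) /=.
rewrite [X in _ = _ + X]big1 ?addn0 => [|i /notin_chi->//].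
by apply: eq_bigr => i; rewrite in_chi; exact: IH.
Qed.

Lemma enum_split (A : {set 'I_d}) i : i \in A ->
  exists l r, [/\ enum A = l ++ i :: r,
    forall j, j \in l -> j < i & forall j, j \in r -> i < j].
Proof.
rewrite -mem_enum => iA; have := enum_set_pairwise A.
case/path.splitPr: iA => l r; rewrite pairwise_cat /= allrel_consr.
case/and3P=> /andP[/allP li _] _ /andP[/allP ir _].
by exists l, r.
Qed.

(** Legality puts the children of the contracted vertex [i] in exactly the place
of [i] in the ordered list of children, and the degree bound holds since all
merged children occupy distinct slots. *)
Lemma dary_contract_shape t t' :
  dary_contract t t' -> br_contract d (shape t) (shape t').
Proof.
elim=> {t t'} [f g i fi [legl legr]|f i t fit IH].
  have iF : i \in chi f by rewrite in_chi fi.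
  have [l [r [E li ir]]] := enum_split iF.
  have pw := enum_set_pairwise (chi f).
  rewrite E pairwise_cat /= allrel_consr in pw.
  have memf j : (j \in chi f :\ i) = (j \in l) || (j \in r).
    rewrite in_setD1 -mem_enum E mem_cat inE.
    have [->|] //= := eqVneq j i.
    by apply/esym/negP => /orP[/li|/ir]; rewrite ltnn.
  have E' : enum (chi (dary_merge f i g)) = l ++ enum (chi g) ++ r.
    apply: enum_set_unique => [|j].
      rewrite !pairwise_cat allrel_catr enum_set_pairwise.
      case/and3P: pw => /andP[_ ->] -> /andP[_ ->]; rewrite !andbT /=.
      apply/andP; split; apply/allrelP => x y.
        move=> xl; rewrite mem_enum => yg; apply: (legl x _ _ y yg).
          by rewrite memf xl.
        exact: li.
      rewrite mem_enum => xg yr; apply: (legr y _ _ x xg).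
        by rewrite memf yr orbT.
      exact: ir.
    rewrite in_chi ffunE memf !mem_cat mem_enum.
    have [jlr|jlr] := boolP ((j \in l) || (j \in r)); last first.
      by rewrite -in_chi; move: jlr; case: (j \in l); case: (j \in r) => //=; rewrite orbF.
    rewrite -in_chi; have := memf j; rewrite jlr => /setD1P[_ ->].
    by case/orP: jlr => ->; rewrite ?orbT.
  have sz : size l + size (enum (chi g)) + size r <= d.
    rewrite -addnA -!size_cat -E' -cardE.
    by rewrite -[X in _ <= X]card_ord max_card.
  have -> : shape (DNode f) = ONode ([seq shape (f j) | j <- l] ++
      ONode [seq shape (g j) | j <- enum (chi g)] :: [seq shape (f j) | j <- r]).
    by rewrite /= E map_cat /= fi.
  have -> : shape (DNode (dary_merge f i g)) =
      ONode ([seq shape (f j) | j <- l] ++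
        [seq shape (g j) | j <- enum (chi g)] ++ [seq shape (f j) | j <- r]).
    rewrite /= E' !map_cat; congr ONode; congr (_ ++ (_ ++ _));
      apply/eq_in_map => j jl; rewrite ffunE memf ?jl ?orbT //.
    case: ifP => //; rewrite -memf => jf; move: jl; rewrite mem_enum => jg.
    have /setD1P[ji _] := jf.
    have [/(legl j jf)/(_ j jg)|/(legr j jf)/(_ j jg)|/val_inj jiE] := ltngtP j i.
    - by rewrite ltnn.
    - by rewrite ltnn.
    - by rewrite jiE eqxx in ji.
  by apply: br_contract_root; rewrite !size_map.
have fi : ~~ is_dempty (f i) by case: fit.
have t0 : ~~ is_dempty t by case: fit.
have [l [r [E li ir]]] : exists l r, [/\ enum (chi f) = l ++ i :: r,
    forall j, j \in l -> j < i & forall j, j \in r -> i < j].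
  by apply: enum_split; rewrite in_chi.
set f' := [ffun j => _].
have f'E j : j != i -> f' j = f j by rewrite ffunE => /negbTE->.
have -> : shape (DNode f') = ONode ([seq shape (f j) | j <- l] ++
    shape t :: [seq shape (f j) | j <- r]).
  have chif' : chi f' = chi f.
    apply/setP=> j; rewrite !in_chi.
    by have [->|/f'E->//] := eqVneq j i; rewrite ffunE eqxx t0 fi.
  rewrite /= chif' E map_cat /= {2}/f' ffunE eqxx; congr (ONode (_ ++ _ :: _));
    apply/eq_in_map => j jl; rewrite f'E //; apply/eqP => ji.
  - by move/li: jl; rewrite ji ltnn.
  - by move/ir: jl; rewrite ji ltnn.
by rewrite /= E map_cat /=; exact: br_contract_sub.
Qed.

(** * Shifting the children of a vertex to new slots *)

(** The pair [(p, b)] sends the child in slot [p] to slot [b]; children are not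
allowed to cross. *)
Definition matching (M : {set 'I_d * 'I_d}) : Prop :=
  {in M &, forall p q : 'I_d * 'I_d, (p.1 < q.1) = (p.2 < q.2)}.

Lemma matching_inj1 M : matching M -> {in M &, injective fst}.
Proof.
move=> mM [i b] [j c] p q /= ij; subst j; congr pair; apply/val_inj/eqP => /=.
have := mM _ _ p q; have := mM _ _ q p; rewrite /= ltnn.
by case: ltngtP.
Qed.

(** If some child has to move right, the rightmost such child is unobstructed:
its right neighbour stays or moves left, hence already lies beyond the target.
If no child has to move right, the leftmost one that has to move left is
unobstructed for the mirror reason. *)
Lemma matching_movable M p0 : matching M -> p0 \in M -> p0.1 != p0.2 ->
  exists2 p, p \in M & p.1 != p.2 /\
    {in M, forall q : 'I_d * 'I_d, (q.1 < p.1 -> q.1 < p.2) /\ (p.1 < q.1 -> p.2 < q.1)}.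
Proof.
move=> mM p0M p0N.
have [/exists_inP[r rM rN]|nor] := boolP [exists r in M, r.1 < r.2].
  have [] := @arg_maxnP _ r [pred p in M | p.1 < p.2] (fun p => p.1) _.
    by rewrite inE rM.
  move=> p /andP[/= pM pN] pmax; exists p => //; split=> [|q qM].
    by rewrite -val_eqE /=; lia.
  split=> [|pq]; first by lia.
  have := pmax q; rewrite /= qM /=.
  by have := mM _ _ pM qM; lia.
have noright q : q \in M -> q.2 <= q.1.
  by move=> qM; rewrite leqNgt; apply: contra nor => ?; apply/exists_inP; exists q.
have [] := @arg_minnP _ p0 [pred p in M | p.2 < p.1] (fun p => p.1) _.
  by rewrite inE p0M /= ltn_neqAle noright // andbT val_eqE eq_sym.
move=> p /andP[/= pM pN] pmin; exists p => //; split=> [|q qM].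
  by rewrite -val_eqE /=; lia.
split=> [qp|]; last by lia.
have := pmin q; rewrite /= qM /=.
by have := mM _ _ qM pM; lia.
Qed.

(** A child that waits in slot [p] to be moved to slot [b] is attached to an
intermediate vertex by an edge of type [b].  Contracting the edge of type [p]
to that vertex performs the shift; the induction is on the number of children
that have not been moved. *)
Lemma dary_contains_shift M f g : matching M ->
  chi g = [set p.1 | p in M] -> chi f = [set p.2 | p in M] ->
  {in M, forall p : 'I_d * 'I_d,
    g p.1 = if p.1 == p.2 then f p.2 else DNode (slot p.2 (f p.2))} ->
  dary_contains (DNode g) (DNode f).
Proof.
have [n] := ubnP #|[set p in M | p.1 != p.2]|.
elim: n M g => // n IH M g /ltnSE leMn mM chig chif gM.
have [/exists_inP[p0 p0M p0N]|fixed] := boolP [exists p in M, p.1 != p.2]; last first.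
  have fx p : p \in M -> p.1 = p.2.
    by move=> pM; apply/eqP; apply: contraNT fixed => ?; apply/exists_inP; exists p.
  have -> : g = f; last exact: rt_refl.
  have chifg : chi g = chi f.
    by rewrite chig chif; apply: eq_in_imset => p /fx.
  apply/ffunP => j; have [|jg] := boolP (j \in chi g).
    by rewrite chig => /imsetP[p pM ->]; rewrite gM // fx // eqxx.
  by rewrite !notin_chi // -chifg.
have [p pM [pN free]] := matching_movable mM p0M p0N.
have gp := gM p pM; rewrite (negbTE pN) in gp.
set h := dary_merge g p.1 (slot p.2 (f p.2)).
have fp : ~~ is_dempty (f p.2) by rewrite -in_chi chif imset_f.
have others j : j \in chi g :\ p.1 -> exists2 q, q \in M :\ p & j = q.1.
  rewrite chig => /setD1P[jp /imsetP[q qM jq]]; exists q => //.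
  by rewrite in_setD1 qM andbT; apply: contraNneq jp => <-; rewrite jq.
have othersM q : q \in M :\ p -> q.1 \in chi g :\ p.1.
  move=> /setD1P[qp qM]; rewrite in_setD1 chig imset_f // andbT.
  by apply: contraNneq qp => /(matching_inj1 mM)->.
apply: (@rt_trans _ _ _ (DNode h)).
  apply: rt_step; apply: dary_contract_root => //.
  by split=> j /others[q /setD1P[_ qM] ->] jp m;
    rewrite in_chi_slot => /andP[/eqP-> _]; have [] := free q qM; auto.
have nb : p.2 \notin chi g :\ p.1.
  apply/negP => /others[q /setD1P[qp qM] E]; have [] := free q qM; rewrite E.
  have : q.1 != p.1 by apply: contraNneq qp => /(matching_inj1 mM)->.
  by rewrite -val_eqE /=; lia.
apply: (IH ((p.2, p.2) |: M :\ p)).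
- apply: leq_trans leMn; apply: proper_card; apply/properP; split.
    apply/subsetP => q; rewrite !inE => /andP[/orP[/eqP->|/andP[_ ->]] //].
    by rewrite eqxx.
  exists p; rewrite !inE ?pM ?pN // eqxx orbF andbT.
  by apply: contraNN pN => /eqP->.
- have key q : q \in M :\ p ->
      (p.2 < q.1) = (p.2 < q.2) /\ (q.1 < p.2) = (q.2 < p.2).
    move=> /setD1P[qp qM]; have [] := free q qM.
    have : q.1 != p.1 by apply: contraNneq qp => /(matching_inj1 mM)->.
    by rewrite -val_eqE /=; have := mM _ _ pM qM; have := mM _ _ qM pM; lia.
  move=> q r /setU1P[->|qM] /setU1P[->|rM] //=.
  + by case: (key r rM).
  + by case: (key q qM).
  by apply: mM; [case/setD1P: qM|case/setD1P: rM].
- apply/setP => j; rewrite imsetU1 /= in_setU1 in_chi ffunE.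
  have [jg|jg] := ifPn.
    have /setD1P[_] := jg; rewrite in_chi => ->; apply/esym/orP; right.
    by have [q qM ->] := others j jg; exact: imset_f.
  rewrite -in_chi in_chi_slot fp andbT; have [//|_] := eqVneq j p.2.
  by apply/esym/negP => /imsetP[q /othersM qM jq]; rewrite jq qM in jg.
- by rewrite imsetU1 /= chif -{1}(setD1K pM) imsetU1.
move=> q /setU1P[->|qM] /=.
  by rewrite eqxx ffunE (negbTE nb) ffunE eqxx.
rewrite ffunE othersM //; case/setD1P: qM => _; exact: gM.
Qed.

(** For a vertex of the [d]-tree with children [s] and a vertex of the d-ary tree
with occupied slots [bs], the partial matching of children becomes a matching
of slots, child number [p] being in slot [p].  The offset [a] makes the
induction on [s] possible. *)
Lemma emb_matching A (x0 : A) (R : A -> 'I_d -> Prop) s bs a :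
  emb R s bs -> pairwise ord_lt bs -> a + size s <= d ->
  exists M, [/\ matching M, [set p.2 | p in M] =i bs &
    {in M, forall p : 'I_d * 'I_d,
      [/\ a <= p.1, p.1 < a + size s & R (nth x0 s (p.1 - a)) p.2]}].
Proof.
move=> e; elim: e a => {s bs} [|x s bs _ IH|x b s bs xb _ IH] a.
- move=> _ _; exists set0; split=> [p q|j|p]; rewrite ?inE //.
  by apply/negbTE/negP => /imsetP[p]; rewrite inE.
- move=> pw /=; rewrite addnS -addSn => sd.
  have [M [mM M2 MR]] := IH _ pw sd; exists M; split=> // p /MR[ap pa].
  by split; rewrite -?(subnSK ap) //; lia.
move=> /= /andP[/allP bbs pw] /[!addnS] sd.
have [M [mM M2 MR]] := IH a.+1 pw sd.
have ad : a < d by lia.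
have bM p : p \in M -> (a < p.1) /\ (b < p.2).
  move=> pM; have [? _ _] := MR p pM; split=> //; apply: bbs.
  by rewrite -M2 imset_f.
exists ((Ordinal ad, b) |: M); split.
- move=> p q /setU1P[->|pM] /setU1P[->|qM] /=; rewrite ?ltnn //.
  + by have [-> ->] := bM q qM.
  + by have [pa pb] := bM p pM; rewrite (ltnNge p.1) (ltnNge p.2) (ltnW pa) (ltnW pb).
  + exact: mM.
- by move=> j; rewrite imsetU1 /= in_setU1 M2 inE.
move=> p /setU1P[->|pM] /=; first by rewrite subnn; split=> //; lia.
have [ap pa Rp] := MR p pM.
by split; [lia|lia|rewrite -(subnSK ap)].
Qed.

(** * Typed prunings of a [d]-tree *)

(** [fits S T]: deleting some subtrees of [S] and giving types to the remaining
edges, compatibly with the order of children, yields [T]. *)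
Inductive fits : otree -> dary d -> Prop :=
| Fits s f : emb (fun S i => fits S (f i)) s (enum (chi f)) ->
    fits (ONode s) (DNode f).

Lemma fits_shape f : fits (shape (DNode f)) (DNode f).
Proof.
suff H t : ~~ is_dempty t -> fits (shape t) t by exact: H.
elim/dary_ffun_ind: t => //= {}f IH _; constructor.
have: {subset enum (chi f) <= chi f} by move=> i; rewrite mem_enum.
elim: (enum _) => [|i s IHs] sub /=; first exact: emb_nil.
apply: emb_cons.
  by apply: IH; rewrite -in_chi sub ?mem_head.
by apply: IHs => j js; rewrite sub // inE js orbT.
Qed.

(** Backward step: a contraction from [S] to [S'] is lifted to one that ends in a
prescribed typed pruning [T'] of [S'].  If some children of the contracted
vertex survive in [T'], in slots [b :: B], they are put below a new vertex in
slot [b], which is the first of them.  The other children of the merged vertex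
all lie to the left or to the right of [b :: B], so that contracting the edge
to the new vertex is legal.  If no child survives, [T'] is already a typed
pruning of [S]: the contracted vertex counts as deleted. *)
Lemma fits_contract S S' T' : br_contract d S S' -> fits S' T' ->
  exists2 T, fits S T & dary_contains T T'.
Proof.
move=> c; elim: c T' => {S S'} [l cs r _|l r t t' _ IH] T' fT.
  have [f] : exists2 f, T' = DNode f & emb (fun S i => fits S (f i)) (l ++ cs ++ r) (enum (chi f)).
    by inversion fT; subst; exists f.
  move=> -> {T' fT} /emb_catl[A [BC [E eA /emb_catl[B [C [EBC eB eC]]]]]].
  subst BC; case: B E eB => [|b B] E eB.
    exists (DNode f); last exact: rt_refl.
    by constructor; rewrite E; apply: emb_cat => //; exact: emb_skip.
  have pw := enum_set_pairwise (chi f); rewrite E in pw.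
  have memE j : (j \in chi f) = [|| j \in A, j \in b :: B | j \in C].
    by rewrite -mem_enum E !mem_cat.
  move: pw; rewrite !pairwise_cat allrel_catr.
  case/and3P=> /andP[/allrelP AB /allrelP AC] pA /and3P[/allrelP BC pB pC].
  have [/allP bB pB'] : all (ord_lt b) B /\ pairwise ord_lt B.
    by move: pB => /= /andP[].
  have AN j : j \in A -> j \notin b :: B.
    by move=> jA; apply/negP => /(AB j j jA); rewrite /ord_lt /= ltnn.
  have CN j : j \in C -> j \notin b :: B.
    by move=> jC; apply/negP => jB; have := BC j j jB jC; rewrite /ord_lt /= ltnn.
  (* [g] is the new vertex, and [f'] the vertex it hangs from. *)
  pose g := [ffun j => if j \in b :: B then f j else DEmpty].
  pose f' := [ffun j => if j == b then DNode g
    else if j \in B then DEmpty else f j].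
  have f'N j : j \notin b :: B -> f' j = f j.
    by rewrite inE negb_or ffunE => /andP[/negbTE-> /negbTE->].
  have chig : enum (chi g) = b :: B.
    apply: enum_set_unique => // j; rewrite in_chi ffunE.
    by case: ifP => // jB; rewrite -in_chi memE jB orbT.
  have chif' : enum (chi f') = A ++ b :: C.
    apply: enum_set_unique => [|j].
      rewrite pairwise_cat pA /= pC andbT; apply/andP; split.
        apply/allrelP => x y xA; rewrite inE => /predU1P[->|]; last exact: AC.
        by apply: AB => //; exact: mem_head.
      by apply/allP => x; apply: BC; exact: mem_head.
    rewrite mem_cat inE in_chi ffunE; have [->|jb] := eqVneq j b.
      by rewrite orbT.
    case: ifP => jB /=.
      by apply/negbTE/norP; split; apply/negP; [move/AN|move/CN];
        rewrite inE jB orbT.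
    by rewrite -in_chi memE inE (negbTE jb) jB.
  exists (DNode f').
    constructor; rewrite chif'; apply: emb_cat.
      by apply: emb_sub eA => S j jA; rewrite f'N ?AN.
    apply: emb_cons; last by apply: emb_sub eC => S j jC; rewrite f'N ?CN.
    rewrite ffunE eqxx; constructor; rewrite chig.
    by apply: emb_sub eB => S j jB; rewrite ffunE jB.
  have others j : j \in chi f' :\ b -> j \in A \/ j \in C.
    rewrite in_setD1 -mem_enum chif' mem_cat inE => /andP[/negbTE->].
    by move/orP.
  have -> : f = dary_merge f' b g.
    apply/ffunP => j; rewrite ffunE.
    have [jB|jB] := boolP (j \in b :: B).
      case: ifP => [/others[/AN|/CN]|_]; rewrite ?jB //.
      by rewrite ffunE jB.
    rewrite in_setD1 in_chi f'N //; case: ifP => //.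
    have -> : j != b by move: jB; rewrite inE negb_or => /andP[].
    by rewrite ffunE (negbTE jB); case: (f j).
  apply: rt_step; apply: dary_contract_root; first by rewrite ffunE eqxx.
  have memg m : m \in chi g -> m \in b :: B by rewrite -mem_enum chig.
  have bBm := mem_head b B.
  split=> j /others[jA|jC] jb m /memg mB.
  - exact: AB.
  - by have := BC b j bBm jC; rewrite /ord_lt /= => /(ltn_trans jb); rewrite ltnn.
  - by have := AB j b jA bBm; rewrite /ord_lt /= => /(ltn_trans jb); rewrite ltnn.
  - exact: BC.
have [f] : exists2 f, T' = DNode f & emb (fun S i => fits S (f i)) (l ++ t' :: r) (enum (chi f)).
  by inversion fT; subst; exists f.
move=> -> {T' fT} /emb_catl[A [BC [E eA eBC]]].
have [e|[b [C [EBC fb eC]]]] := emb_consl eBC.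
  exists (DNode f); last exact: rt_refl.
  by constructor; rewrite E; apply: emb_cat => //; exact: emb_skip.
subst BC; have [u fu uf] := IH _ fb.
pose f' := [ffun j => if j == b then u else f j].
have u0 : ~~ is_dempty u by case: fu.
have fb0 : ~~ is_dempty (f b) by case: fb.
have pw := enum_set_pairwise (chi f).
rewrite E pairwise_cat /= allrel_consr in pw.
case/and3P: pw => /andP[/allP Ab _] _ /andP[/allP bC _].
have f'N j : j != b -> f' j = f j by rewrite ffunE => /negbTE->.
have chif' : chi f' = chi f.
  apply/setP=> j; rewrite !in_chi.
  by have [->|/f'N->//] := eqVneq j b; rewrite ffunE eqxx u0 fb0.
exists (DNode f').
  constructor; rewrite chif' E; apply: emb_cat.
    apply: emb_sub eA => S j jA; rewrite f'N //.
    by apply: contraTneq (Ab j jA) => ->; rewrite /ord_lt /= ltnn.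
  apply: emb_cons; first by rewrite ffunE eqxx.
  apply: emb_sub eC => S j jC; rewrite f'N //.
  by apply: contraTneq (bC j jC) => ->; rewrite /ord_lt /= ltnn.
have -> : f = [ffun j => if j == b then f b else f' j].
  apply/ffunP => j; rewrite !ffunE; case: eqP => // ->//.
by apply: dary_contains_sub; rewrite ffunE eqxx.
Qed.

Lemma fits_contains S S' T' : br_contains d S S' -> fits S' T' ->
  exists2 T, fits S T & dary_contains T T'.
Proof.
move=> c; elim: c T' => {S S'} [S S' c|S|S1 S2 S3 _ IH1 _ IH2] T'.
- by move=> fT; exact: fits_contract c fT.
- by move=> fT; exists T' => //; exact: rt_refl.
move=> /IH2[T2 /IH1[T1 f1 c1] c2]; exists T1 => //; exact: rt_trans c1 c2.
Qed.

(** The path for child number [p] shrinks to nothing if its type in [T] is [p],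
and otherwise to one edge of the required type below slot [p]; then the
children are shifted into their slots. *)
Lemma expand_contains l S T : (forall i b, b != i -> b \in l i) ->
  is_brtree d S -> fits S T -> dary_contains (expand l S) T.
Proof.
move=> lE; elim/otree_nth_ind: S T => s IH T /= /andP[sd brs] fT.
have [f] : exists2 f, T = DNode f & emb (fun S i => fits S (f i)) s (enum (chi f)).
  by inversion fT; subst; exists f.
move=> -> {T fT} e.
have [M [mM M2 MR]] := emb_matching oleaf (a := 0) e (enum_set_pairwise _) sd.
have f0 p : p \in M -> ~~ is_dempty (f p.2).
  by move=> pM; rewrite -in_chi -mem_enum -M2 imset_f.
pose g := [ffun i => if [pick p in M | p.1 == i] is Some p then
  if p.1 == p.2 then f p.2 else DNode (slot p.2 (f p.2)) else DEmpty].
have gM p : p \in M ->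
    g p.1 = if p.1 == p.2 then f p.2 else DNode (slot p.2 (f p.2)).
  move=> pM; rewrite ffunE; case: pickP => [q /andP[qM /eqP qp]|/(_ p)].
    by rewrite (matching_inj1 mM qM pM qp).
  by rewrite pM eqxx.
have chig : chi g = [set p.1 | p in M].
  apply/setP => i; rewrite in_chi; apply/idP/imsetP => [|[p pM ->]].
    by rewrite ffunE; case: pickP => // p /andP[pM /eqP pi] _; exists p.
  by rewrite gM //; case: eqP => // _; exact: f0.
apply: (@rt_trans _ _ _ (DNode g)); last first.
  apply: (dary_contains_shift mM chig _ gM).
  by apply/setP => i; rewrite M2 mem_enum.
apply: dary_contains_slots => i; rewrite -in_chi chig => /imsetP[p pM ->].
have [_ ps Rp] := MR p pM; rewrite add0n subn0 in ps Rp.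
rewrite gM // ffunE ps expand_slot //.
have sub := IH _ ps _ (all_nthP oleaf brs _ ps) Rp.
apply: rt_trans (typed_path_contains _ sub) _.
case: eqP => [_|/eqP pN]; first by apply: typed_path_contains_end; exact: f0.
by apply: typed_path_contains_slot; [exact: f0|rewrite lE // eq_sym].
Qed.

End Dary.

Theorem theorem3p5 (d k : nat) (hd : 2 <= d) (hk : 1 <= k) :
  N_br_non d k <= N_dary_non d k <= d * (N_br_non d k - 1) + 1.
Proof.
have d0 : 0 < d by exact: ltnW.
rewrite /N_br_non /N_dary_non.
case: ex_minnP => n /asboolP[S [brS sS uS]] minn.
case: ex_minnP => m /asboolP[D [sD uD]] minm.
apply/andP; split.
  have DN : ~~ is_dempty D.
    case: D uD {sD} => // uD.
    (* Any tree with [k] vertices will do to exclude an empty [D]. *)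
    pose T := iter k (fun t => DNode (slot (Ordinal d0) t)) (@DEmpty d).
    have sT : dary_size T = k.
      by rewrite /T; elim: (k) => // p IH; rewrite iterS dary_size_slot IH.
    have := is_dempty_contains (uD T sT).
    by case: (T) sT => //= sT _; move: hk; rewrite -sT.
  apply: minn; apply/asboolP; exists (shape D); split.
  - exact: is_brtree_shape.
  - by rewrite -sD; case: D DN {uD sD} => // f _; exact: otree_size_shape.
  move=> T brT sT; rewrite -(shape_expand_nil brT).
  have : dary_contains D (expand (fun=> [::]) T).
    apply: uD; rewrite (dary_size_expand (w := 0)) //.
    by case: T sT {brT} => s /=; lia.
  elim=> [t t' c|t|t1 t2 t3 _ c1 _ c2].
  - by apply: rt_step; exact: dary_contract_shape.
  - exact: rt_refl.
  - exact: rt_trans c1 c2.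
pose l (i : 'I_d) := enum (predC1 i).
have sl i : size (l i) = d.-1 by rewrite -cardE cardC1 card_ord.
have -> : d * (n - 1) + 1 = dary_size (expand l S).
  by rewrite (dary_size_expand sl) // sS prednK.
apply: minm; apply/asboolP; exists (expand l S); split=> // -[|f] sT.
  by move: hk; rewrite -sT.
(* The given tree is a typed pruning of its own shape, with nothing deleted. *)
have [T fT cT] := fits_contains
  (uS _ (is_brtree_shape (DNode f)) (etrans (otree_size_shape f) sT))
  (fits_shape f).
apply: rt_trans cT; apply: expand_contains => // i b bi.
by rewrite mem_enum inE.
Qed.
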